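(* Let $n\geq 1$, let $X_1,\ldots,X_n$ be independent real random variables with common distribution $\mu$ having finite variance, let $X\sim\mu$ with $\mathbf{E}X^2>0$, and let $\delta\in(0,1)$. In both cases below let $s>0$ be given by $s^{2} = n\,\mathbf{E}X^{2}/(2\log(\delta^{-1}))$. (Additive case) Let $\beta>0$ be given by $\beta^{2} = n/s^{2}$, and consider noise $\rho = \text{Normal}(0,\beta^{-1})$ (with prior $\nu = \text{Normal}(1,\beta^{-1})$). Then the additive-noise estimator $\widehat{x}_{\mathrm{A}}$ built with $\rho$ and $s$ satisfies $$|\widehat{x}_{\mathrm{A}} - \mathbf{E}X| \leq \sqrt{\frac{2\,\mathbf{E}X^{2}\log(\delta^{-1})}{n}} + \frac{1}{\sqrt{n}}$$ with probability no less than $1-2\delta$ over the draw of the sample. (Multiplicative case) Let $\beta>0$ be given by $\beta^{2} = n\,\mathbf{E}X^{2}/s^{2}$, and consider noise $\rho = \text{Normal}(1,\beta^{-1})$ (with prior $\nu = \text{Normal}(2,\beta^{-1})$). Then the multiplicative-noise estimator $\widehat{x}_{\mathrm{M}}$ built with $\rho$ and $s$ satisfies $$|\widehat{x}_{\mathrm{M}} - \mathbf{E}X| \leq \sqrt{\frac{2\,\mathbf{E}X^{2}\log(\delta^{-1})}{n}} + \sqrt{\frac{\mathbf{E}X^{2}}{n}}$$ with probability no less than $1-2\delta$ over the draw of the sample.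
   Context: The truncation function $\psi:\mathbb{R}\to\mathbb{R}$ is $$\psi(u) = \begin{cases} u - u^{3}/6, & -\sqrt{2}\leq u\leq \sqrt{2},\\ 2\sqrt{2}/3, & u>\sqrt{2},\\ -2\sqrt{2}/3, & u<-\sqrt{2}.\end{cases}$$ Given a scale $s>0$ and noise $\epsilon_1,\ldots,\epsilon_n$ that are i.i.d. with distribution $\rho$ and independent of the data, the multiplicative-noise and additive-noise estimators are $$\widehat{x}_{\mathrm{M}} = \mathbf{E}_{\epsilon}\left(\frac{s}{n}\sum_{i=1}^{n}\psi\left(\frac{X_i\epsilon_i}{s}\right)\right), \qquad \widehat{x}_{\mathrm{A}} = \mathbf{E}_{\epsilon}\left(\frac{s}{n}\sum_{i=1}^{n}\psi\left(\frac{X_i+\epsilon_i}{s}\right)\right),$$ where $\mathbf{E}_\epsilon$ is expectation over the noise only (data held fixed), so the only remaining randomness is that of the data. $\text{Normal}(m,v)$ has mean $m$ and variance $v$. $\mathbf{E}X$ and $\mathbf{E}X^2$ are moments under $\mu$. The prior $\nu$ is an auxiliary distribution that enters neither the estimator nor the conclusion. *)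

(* Defs.v *)
From HB Require Import structures.
Set Warnings "-notation-overridden,-notation-incompatible-prefix".
From mathcomp Require Export all_boot all_order all_algebra.
From mathcomp Require Export all_classical all_reals all_analysis.
Export Order.TTheory GRing.Theory Num.Theory.
Export numFieldNormedType.Exports.

Set Implicit Arguments.
Unset Strict Implicit.
Unset Printing Implicit Defensive.

Local Open Scope classical_set_scope.
Local Open Scope ring_scope.

Definition psi {R : realType} (u : R) : R :=
  if - Num.sqrt 2 <= u <= Num.sqrt 2 then u - u ^+ 3 / 6
  else if Num.sqrt 2 < u then 2 * Num.sqrt 2 / 3
  else - (2 * Num.sqrt 2 / 3).

(* [normal_prob] takes the standard deviation, whereas v is the variance. *)
Definition Normal {R : realType} (m v : R) :
    probability (measurableTypeR R) R :=
  normal_prob m (Num.sqrt v).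

(* The first two moments of a law mu, as reals; [fine] loses nothing when mu
   has finite variance. *)
Definition mean {R : realType} (mu : probability (measurableTypeR R) R) : R :=
  fine 'E_mu[(fun x : R => x)%R]%E.

Definition second_moment {R : realType}
    (mu : probability (measurableTypeR R) R) : R :=
  fine 'E_mu[(fun x : R => x ^+ 2)%R]%E.

(* [variance] is centred at the real number [mean mu]; its finiteness forces
   mu to be square integrable, hence [mean mu] to be the true mean. *)
Definition finite_variance {R : realType}
    (mu : probability (measurableTypeR R) R) : Prop :=
  ('V_mu[(fun x : R => x)%R] < +oo)%E.

Definition mutually_independent d (T : measurableType d) (R : realType)
    (P : probability T R) (n : nat) (X : 'I_n -> {RV P >-> R}) : Prop :=
  forall (J : {set 'I_n}) (A : 'I_n -> set R), (forall i, measurable (A i)) ->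
    P (\bigcap_(i in [set` J]) (X i @^-1` A i)) =
    (\prod_(i in J) P (X i @^-1` A i))%E.
Arguments mutually_independent {d T R} P {n} X.

(* Laws are compared on measurable sets only: the values of a measure on other
   sets are meaningless. *)
Definition iid d (T : measurableType d) (R : realType)
    (P : probability T R) (n : nat) (X : 'I_n -> {RV P >-> R})
    (mu : probability (measurableTypeR R) R) : Prop :=
  mutually_independent P X /\
  forall i (A : set R), measurable A -> distribution P (X i) A = mu A.
Arguments iid {d T R} P {n} X mu.

Definition independent_families d (T : measurableType d) (R : realType)
    (P : probability T R) (n : nat) (X Y : 'I_n -> {RV P >-> R}) : Prop :=
  forall A B : set T,
    g_sigma_preimage (fun i => X i : T -> R) A ->
    g_sigma_preimage (fun i => Y i : T -> R) B ->
    P (A `&` B) = (P A * P B)%E.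
Arguments independent_families {d T R} P {n} X Y.

(* In both estimators the data are frozen at the outcome w, and the expectation
   is taken over the outcome w' that drives the noise. *)
Definition multiplicative_estimator d (T : measurableType d) (R : realType)
    (P : probability T R) (n : nat) (s : R)
    (X eps : 'I_n -> {RV P >-> R}) (w : T) : R :=
  fine 'E_P[(fun w' =>
    s / n%:R * \sum_(i < n) psi (X i w * eps i w' / s))%R]%E.
Arguments multiplicative_estimator {d T R} P {n} s X eps w.

Definition additive_estimator d (T : measurableType d) (R : realType)
    (P : probability T R) (n : nat) (s : R)
    (X eps : 'I_n -> {RV P >-> R}) (w : T) : R :=
  fine 'E_P[(fun w' =>
    s / n%:R * \sum_(i < n) psi ((X i w + eps i w') / s))%R]%E.
Arguments additive_estimator {d T R} P {n} s X eps w.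

(* Main.v *)
Require Import Defs.
From mathcomp Require Import measurable_realfun ring lra.

(** Since the noise law is fixed, no PAC-Bayesian bound over posteriors is
    needed.  The truncation satisfies [exp (psi u) <= 1 + u + u^2 / 2] and is
    odd, so for [G x = E_eps (psi (h x eps / s))], where [h x e] is [x + e] or
    [x * e], Jensen's inequality gives
    [exp (± G x) <= 1 ± x / s + (a x^2 + b) / (2 s^2)],
    [a x^2 + b] being a bound for [E_eps (h x eps)^2].  Integrating in [x] and
    using [1 + y <= exp y], Chernoff's method for the independent [G (X_i)]
    bounds each of the two tails by [delta].
    The second moment of the centred noise enters only through
    [E Z^2 <= 2 / beta], twice the true variance: the factor 2 is the slack in
    the second term of the stated bounds.  It follows from the moment
    generating function of the normal law and [2 + z^2 <= exp z + exp (- z)]. *)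

Set Implicit Arguments.
Unset Strict Implicit.

Local Open Scope classical_set_scope.
Local Open Scope ring_scope.

(** * The truncation function and its exponential bound *)

Section truncation.
Context {R : realType}.
Implicit Types u : R.

Lemma psiN u : psi (- u) = - psi u.
Proof.
have s0 : 0 <= Num.sqrt 2 :> R := sqrtr_ge0 _.
rewrite /psi.
repeat case: ifP => ?; first [ring | exfalso; lra].
Qed.

Lemma psi_le1 u : `|psi u| <= 1.
Proof.
have s0 : 0 <= Num.sqrt 2 :> R := sqrtr_ge0 _.
have s2 : Num.sqrt 2 ^+ 2 = 2 :> R by rewrite sqr_sqrtr.
(* This puts the plateau value [2 * Num.sqrt 2 / 3] below 1. *)
have s3 : Num.sqrt 2 <= 3 / 2 :> R by nra.
rewrite /psi ler_norml; case: ifP => [|_]; last by case: ifP => _; lra.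
move=> /andP[u1 u2].
have u22 : u ^+ 2 <= 2 by nra.
have [u0|u0] := leP 0 u; apply/andP; split; nra.
Qed.

Lemma measurable_psi : measurable_fun setT (@psi R).
Proof.
rewrite /psi; apply: measurable_fun_ifT => /=.
- apply: measurable_and; exact: measurable_fun_ler.
- apply: measurable_funB => //; exact: measurable_funM.
- by apply: measurable_fun_ifT => //=; exact: measurable_fun_ltr.
Qed.

Let cubic u : R := u - u ^+ 3 / 6.
Let ratio u : R := (1 + u + u ^+ 2 / 2) * expR (- cubic u).
(** The derivative produces the factor [1 + u - (1 + u + u ^+ 2 / 2) * (1 - u ^+ 2 / 2)], in which
    every term of degree below three cancels. *)
Let dratio u : R := expR (- cubic u) * (u ^+ 3 * (2 + u) / 4).

Let is_derive_ratio u : is_derive u 1 ratio (dratio u).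
Proof.
rewrite /ratio /cubic /dratio.
apply: is_derive_eq.
by rewrite /GRing.scale /= /cubic; field.
Qed.

(** The sign of [dratio] is that of [u ^+ 3 * (2 + u)], so [ratio] decreases on [[-2, 0]] and
    increases afterwards: its minimum is [ratio 0 = 1]. *)
Let cubic_le u : - 2 <= u -> expR (cubic u) <= 1 + u + u ^+ 2 / 2.
Proof.
move=> u2; suff : 1 <= ratio u.
  by rewrite /ratio expRN ler_pdivlMr ?expR_gt0// mul1r.
have ratio0 : ratio 0 = 1 by rewrite /ratio /cubic; rewrite !expr0n/= !mul0r subr0 oppr0 expR0; lra.
have cr : continuous ratio.
  by move=> x; apply: differentiable_continuous; apply/derivable1_diffP; case: (is_derive_ratio x).
have [u0|u0] := leP 0 u.
- have [||c] := @MVT_segment R ratio dratio 0 u u0.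
  + by move=> x _; exact: is_derive_ratio.
  + exact: continuous_subspaceT.
  rewrite ratio0 in_itv/= => /andP[c0 cu] E.
  rewrite -subr_ge0 E subr0 mulr_ge0// mulr_ge0 ?expR_ge0//.
  by rewrite mulr_ge0// mulr_ge0 ?exprn_ge0//; lra.
- have [||c] := @MVT_segment R ratio dratio u 0 (ltW u0).
  + by move=> x _; exact: is_derive_ratio.
  + exact: continuous_subspaceT.
  rewrite ratio0 in_itv/= => /andP[cu c0] E.
  rewrite -subr_ge0 -oppr_le0 opprB E sub0r mulr_le0_ge0 ?oppr_ge0 ?(ltW u0)//.
  rewrite mulr_ge0_le0 ?expR_ge0//.
  suff : c ^+ 3 * (2 + c) <= 0 by lra.
  rewrite mulr_le0_ge0//; last by lra.
  have : 0 <= c ^+ 2 by exact: sqr_ge0.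
  rewrite (exprS c 2); nra.
Qed.

(** Inside the interval this is [cubic_le]. Outside, [psi] is frozen at its value at the nearer
    endpoint, while the quadratic, whose vertex is at -1, only grows away from the interval because
    [1 <= Num.sqrt 2]. *)
Lemma expR_psi_le u : expR (psi u) <= 1 + u + u ^+ 2 / 2.
Proof.
have s0 : 0 <= Num.sqrt 2 :> R := sqrtr_ge0 _.
have s2 : Num.sqrt 2 ^+ 2 = 2 :> R by rewrite sqr_sqrtr.
have s3 : 1 <= Num.sqrt (2 : R) <= 3 / 2 by apply/andP; split; nra.
have s33 : Num.sqrt 2 ^+ 3 = 2 * Num.sqrt 2 :> R by rewrite exprSr s2.
rewrite /psi; case: ifP => [/andP[u1 u2]|uF].
  by apply: cubic_le; lra.
case: ifP => [u1|u1].
  have -> : 2 * Num.sqrt 2 / 3 = cubic (Num.sqrt 2) :> R.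
    by rewrite /cubic s33; lra.
  apply: le_trans (cubic_le _) _; first by lra.
  nra.
have -> : - (2 * Num.sqrt 2 / 3) = cubic (- Num.sqrt 2) :> R.
  rewrite /cubic -[(- _) ^+ 3]/((- _) ^+ 2.+1) exprS sqrrN s2; lra.
apply: le_trans (cubic_le _) _; first by lra.
have : u < - Num.sqrt 2 by move: uF; case: (leP _ u) => //= _; case: (leP u) => //=; lra.
nra.
Qed.

End truncation.

(** * Integration against the image of a weighted measure *)

Section density.
Context d d' (T : measurableType d) (T' : measurableType d') (R : realType).
Variables (m : {measure set T -> \bar R}) (m' : {measure set T' -> \bar R}).
Variables (Y : T -> T') (W : T -> R).
Hypotheses (mY : measurable_fun setT Y) (mW : measurable_fun setT W).
Hypothesis W0 : forall x, 0 <= W x.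
Hypothesis m'E : forall A, measurable A ->
  m' A = (\int[m]_x (\1_A (Y x) * W x)%:E)%E.

Import HBNNSimple.

(** By hypothesis the formula holds for indicators; linearity extends it to simple functions and
    monotone convergence to nonnegative ones. It serves both for products of independent factors and
    for the normal density. *)
Lemma ge0_integral_density (f : T' -> \bar R) : measurable_fun [set: T'] f ->
  (forall y, (0 <= f y)%E) ->
  (\int[m']_y f y = \int[m]_x (f (Y x) * (W x)%:E))%E.
Proof.
move=> mf f0; pose h := nnsfun_approx measurableT mf.
have -> : (\int[m']_y f y = lim (\int[m']_y (h n y)%:E @[n --> \oo]))%E.
  rewrite -monotone_convergence//.
  - apply: eq_integral => y _; apply/esym/cvg_lim => //.
    by apply: cvg_nnsfun_approx => //.
  - by move=> n; exact/measurable_EFinP/measurable_funP.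
  - by move=> n y _; rewrite lee_fin.
  - by move=> y _ a b ab; rewrite lee_fin; exact/lefP/nd_nnsfun_approx.
have mhY n : measurable_fun setT (fun x => h n (Y x)).
  by apply: measurableT_comp => //; exact/measurable_funP.
transitivity (lim (\int[m]_x ((h n (Y x))%:E * (W x)%:E) @[n --> \oo]))%E; last first.
  rewrite -monotone_convergence//.
  - apply: eq_integral => x _; apply/cvg_lim => //; apply: cvgeZr => //.
    by apply: cvg_nnsfun_approx => //.
  - by move=> n; apply/measurable_EFinP; exact: measurable_funM.
  - by move=> n x _; rewrite -EFinM lee_fin mulr_ge0.
  - move=> x _ a b ab; rewrite -!EFinM lee_fin ler_wpM2r//.
    exact/lefP/nd_nnsfun_approx.
congr (lim _).
suff : (fun n => \int[m']_y (h n y)%:E)%E = (fun n => \int[m]_x ((h n (Y x))%:E * (W x)%:E))%E by move=> ->.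
apply/funext => n.
under eq_integral do rewrite fimfunE -fsumEFin//.
rewrite ge0_integral_fsum//; last 2 first.
- by move=> r; exact/measurable_EFinP/measurable_funM.
- by move=> r x _; rewrite nnfun_muleindic_ge0.
have mi r : measurable_fun setT (fun x => \1_(h n @^-1` [set r]) (Y x) : R).
  exact: measurableT_comp.
have -> : (\int[m]_x ((h n (Y x))%:E * (W x)%:E) =
  \int[m]_x (\sum_(r \in range (h n)) (r * (\1_(h n @^-1` [set r]) (Y x) * W x))%:E))%E.
  apply: eq_integral => x _; rewrite (fimfunE (h n) (Y x)) -EFinM fsumEFin//.
  congr EFin; rewrite mulr_fsuml //.
  by apply: eq_fsbigr => r _; rewrite mulrA.
rewrite ge0_integral_fsum//; last 2 first.
- by move=> r; apply/measurable_EFinP; apply: measurable_funM => //; exact: measurable_funM.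
- by move=> r x _; rewrite mulrA EFinM mule_ge0 ?lee_fin// -lee_fin nnfun_muleindic_ge0.
apply: eq_fsbigr => r rh.
have r0 : 0 <= r by move: rh; rewrite inE => -[t _ <-].
under eq_integral do rewrite EFinM.
rewrite ge0_integralZl//; last exact/measurable_EFinP.
under [in RHS]eq_integral do rewrite EFinM.
rewrite ge0_integralZl//; last 2 first.
- by apply/measurable_EFinP; exact: measurable_funM.
- by move=> x _; rewrite lee_fin mulr_ge0.
by rewrite -m'E// integral_indic// setIT.
Qed.

End density.

(** * Product formula and Chernoff bound for independent variables *)

Section independent_product.
Context d (T : measurableType d) (R : realType) (P : probability T R) (n : nat).
Variable X : 'I_n -> {RV P >-> R}.
Hypothesis X_indep : mutually_independent P X.

Let Q (g : 'I_n -> R -> R) : Prop :=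
  (\int[P]_w (\prod_i g i (X i w))%:E = \prod_i \int[P]_w (g i (X i w))%:E)%E.

Let admissible (g : 'I_n -> R -> R) : Prop :=
  forall i, [/\ measurable_fun setT (g i), forall x, 0 <= g i x &
    (\int[P]_w (g i (X i w))%:E < +oo)%E].

Let mgX g i : admissible g -> measurable_fun setT (fun w => g i (X i w)).
Proof. by move=> /(_ i)[mg _ _]; exact: measurableT_comp. Qed.

Let indicator_product (A : 'I_n -> set R) :
  (forall i, measurable (A i)) -> Q (fun i => \1_(A i)).
Proof.
move=> mA; rewrite /Q.
have mXA i : measurable (X i @^-1` A i) by rewrite -[_ @^-1` _]setTI; exact: measurable_funPT.
under [in RHS]eq_bigr => i _ do rewrite [X in (\int[_]_w X w)%E](_ : _ = fun w => (\1_(X i @^-1` A i) w)%:E)// integral_indic// setIT.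
transitivity (P (\bigcap_(i in [set` [set: 'I_n]%SET]) (X i @^-1` A i))); last first.
  by rewrite X_indep//; apply: eq_bigl => i; rewrite inE.
have -> : \bigcap_(i in [set` [set: 'I_n]%SET]) (X i @^-1` A i) = \bigcap_i (X i @^-1` A i).
  by apply: eq_bigcapl; split=> i //= _; rewrite inE.
have mI : measurable (\bigcap_i (X i @^-1` A i)).
  by apply: fin_bigcap_measurable.
rewrite -[X in P X]setIT -integral_indic//.
apply: eq_integral => w _; congr EFin.
have [wA|] := pselect (forall i, A i (X i w)).
  rewrite big1 => [|i _]; last by rewrite indicE mem_set.
  by rewrite indicE mem_set// => i _; exact: wA.
move=> /existsNP[i iA].
rewrite (bigD1 i)//= indicE memNset// mul0r indicE memNset// => /(_ i Logic.I).
exact: iA.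
Qed.

Lemma independent_integral_prod (g : 'I_n -> R -> R) :
  (forall i, measurable_fun setT (g i)) -> (forall i x, 0 <= g i x) ->
  (forall i, (\int[P]_w (g i (X i w))%:E < +oo)%E) ->
  (\int[P]_w (\prod_i g i (X i w))%:E = \prod_i \int[P]_w (g i (X i w))%:E)%E.
Proof.
move=> mg g0 gfin.
(* The factors with index at least k are indicators; k runs from 0 to n. *)
suff H k : forall g, admissible g ->
    (forall i : 'I_n, (k <= i)%N -> exists2 A, measurable A & g i = \1_A) -> Q g.
  by apply: (H n) => // i; rewrite leqNgt ltn_ord.
elim: k {g mg g0 gfin} => [|k IH] g adm gA.
  pose A i := xget set0 [set A | measurable A /\ g i = \1_A].
  have AP i : measurable (A i) /\ g i = \1_(A i).
    have [B mB gB] := gA i (leq0n _).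
    by apply: (@xgetPex _ set0 [set A | measurable A /\ g i = \1_A]); exists B.
  have -> : g = fun i => \1_(A i) by apply/funext => i; case: (AP i).
  by apply: indicator_product => i; case: (AP i).
have [nk|kn] := leqP n k.
  by apply: IH => // i; rewrite leqNgt (leq_trans (ltn_ord i) nk).
pose i0 := Ordinal kn.
pose c := (\prod_(i | i != i0) \int[P]_w (g i (X i w))%:E)%E.
have c0 : (0 <= c)%E.
  apply: prode_ge0 => i _; apply: integral_ge0 => w _.
  by case: (adm i) => _ g0 _; rewrite lee_fin.
(* Finiteness allows [c] to act as a real scaling factor of a measure. *)
have cfin : c \is a fin_num.
  rewrite /c; apply: (big_ind (fun x : \bar R => x \is a fin_num)) => // [x y|i _]; first exact: fin_numM.
  rewrite ge0_fin_numE; first by case: (adm i).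
  apply: integral_ge0 => w _.
  by case: (adm i) => _ g0 _; rewrite lee_fin.
pose W w := \prod_(i | i != i0) g i (X i w).
have mW : measurable_fun setT W.
  rewrite /W; under eq_fun do rewrite -big_filter.
  by apply: measurable_prod => i _; exact: mgX.
have W0 w : 0 <= W w by apply: prodr_ge0 => i _; case: (adm i).
have fc0 : 0 <= fine c by rewrite fine_ge0.
(* With the other factors fixed and [g i0] replaced by [\1_A], both sides of the product formula are
   measures in [A]. The induction hypothesis makes them equal, so [g i0] has the same integral
   against both. *)
pose m' := mscale (NngNum fc0) (distribution P (X i0)).
have m'E A : measurable A -> (m' A = \int[P]_w (\1_A (X i0 w) * W w)%:E)%E.
  move=> mA; pose h i := if i == i0 then \1_A else g i.
  have hE i : i != i0 -> h i = g i by rewrite /h => /negbTE ->.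
  have hi0 : h i0 = \1_A by rewrite /h eqxx.
  have mXA : measurable (X i0 @^-1` A) by rewrite -[_ @^-1` _]setTI; exact: measurable_funPT.
  have intA : (\int[P]_w (\1_A (X i0 w))%:E = distribution P (X i0) A)%E.
    rewrite [X in (\int[_]_w X w)%E](_ : _ = fun w => (\1_(X i0 @^-1` A) w)%:E)//.
    by rewrite integral_indic// setIT.
  have admh : admissible h.
    move=> i; have [->|ii0] := eqVneq i i0; last by rewrite hE.
    rewrite hi0; split => //.
    by rewrite intA; apply: le_lt_trans (probability_le1 _ _) _ => //; rewrite ltry.
  have /(IH _ admh) : forall i : 'I_n, (k <= i)%N -> exists2 A, measurable A & h i = \1_A.
    move=> i ki; have [->|ii0] := eqVneq i i0; first by exists A.
    rewrite hE//; apply: gA; rewrite ltn_neqAle ki andbT.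
    by apply: contraNneq ii0 => kE; apply/eqP/val_inj.
  rewrite /Q (bigD1 i0)//= hi0 intA.
  under eq_bigr => i ii0 do rewrite hE//.
  rewrite -/c => E.
  under eq_integral => w _.
    have -> : \1_A (X i0 w) * W w = \prod_i h i (X i w).
      rewrite (bigD1 i0)//= hi0; congr (_ * _).
      by apply: eq_bigr => i ii0; rewrite hE.
    over.
  by rewrite E /m' /mscale/= fineK// muleC.
rewrite /Q (bigD1 i0)//= -/c.
have [mg0 g00 _] := adm i0.
have mEg : measurable_fun [set: R] (fun x => (g i0 x)%:E) by exact/measurable_EFinP.
have := ge0_integral_density (measurable_funPT (X i0)) mW W0 m'E mEg.
rewrite ge0_integral_mscale// => [H|x _]; last by rewrite lee_fin.
rewrite muleC -[c]fineK// -(@ge0_integral_distribution _ _ _ _ _ P (X i0) (fun x => (g i0 x)%:E))//.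
rewrite H => [|x]; last by rewrite lee_fin.
by apply: eq_integral => w _; rewrite -EFinM (bigD1 i0).
Qed.

(** Markov's inequality for the exponential of the sum, whose expectation factors by independence
    and is at most [expR c] to the power [n]. *)
Lemma independent_chernoff (G : 'I_n -> R -> R) (c L : R) :
  (forall i, measurable_fun setT (G i)) ->
  (forall i, \int[P]_w (expR (G i (X i w)))%:E <= (expR c)%:E)%E ->
  (P [set w | (n%:R * c + L <= \sum_i G i (X i w))%R] <= (expR (- L))%:E)%E.
Proof.
move=> mG Gc; set S := [set w | _].
have mGX i : measurable_fun setT (fun w => G i (X i w)) by exact: measurableT_comp.
have msum : measurable_fun setT (fun w => \sum_i G i (X i w)) by exact: measurable_sum.
have mS : measurable S.
  rewrite /S -[X in measurable X]setTI.
  exact: (measurable_fun_ler (measurable_cst _) msum measurableT (I : measurable [set true])).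
rewrite -[X in P X]setIT -integral_indic//.
(* On [S] the product of the exponentials is at least the inverse of [k], so [k] times this product
   dominates [\1_S]. *)
pose k := expR (- (n%:R * c + L)).
have mprod : measurable_fun setT (fun w => \prod_i expR (G i (X i w))).
  by apply: measurable_prod => i _; exact: measurableT_comp.
apply: (@le_trans _ _ (\int[P]_w (k * \prod_i expR (G i (X i w)))%:E))%E.
  apply: ge0_le_integral => //.
  - by apply/measurable_EFinP.
  - by apply/measurable_EFinP; exact: measurable_funM.
  - move=> w _; rewrite lee_fin indicE -expR_sum /k -expRD.
    have [wS|wS] := boolP (w \in S); last by rewrite expR_ge0.
    move: wS; rewrite inE /S/= => wS.
    by rewrite -[leLHS]expR0 ler_expR addrC subr_ge0.
under eq_integral do rewrite EFinM.
rewrite ge0_integralZl//; last 3 first.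
- exact/measurable_EFinP.
- by move=> w _; rewrite lee_fin prodr_ge0// => i _; rewrite expR_ge0.
- by rewrite lee_fin expR_ge0.
rewrite (independent_integral_prod (g := fun i => expR \o G i))/=; last 3 first.
- by move=> i; exact: measurableT_comp.
- by move=> i x; exact: expR_ge0.
- by move=> i; rewrite (le_lt_trans (Gc i))// ltry.
apply: (@le_trans _ _ (k%:E * \prod_(i < n) (expR c)%:E)%E).
  rewrite lee_wpmul2l ?lee_fin ?expR_ge0//.
  (* Multiplying inequalities between extended reals needs nonnegative factors, so the induction
     carries the lower bound 0 along. *)
  suff : (0 <= \prod_(i < n) \int[P]_w (expR (G i (X i w)))%:E <= \prod_(i < n) (expR c)%:E)%E.
    by case/andP.
  apply: (big_ind2 (fun x y : \bar R => 0 <= x <= y)%E) => [|x1 x2 y1 y2|i _].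
  - by rewrite lexx lee_fin ler01.
  - by move=> /andP[x10 x12] /andP[y10 y12]; rewrite mule_ge0//= lee_pmul.
  - by rewrite Gc andbT integral_ge0// => x _; rewrite lee_fin expR_ge0.
rewrite prodEFin -EFinM lee_fin prodr_const card_ord -expRM_natl /k -expRD ler_expR.
by rewrite -mulr_natl; lra.
Qed.

End independent_product.

(** * A quadratic lower bound for the hyperbolic cosine *)

Lemma sqr_le_expRDN (R : realType) (z : R) : 2 + z ^+ 2 <= expR z + expR (- z).
Proof.
wlog z0 : z / 0 <= z => [H|].
  have [/H //|z0] := leP 0 z.
  by have := H (- z); rewrite oppr_ge0 opprK sqrrN addrC [X in _ -> _ <= X]addrC addrC; apply; exact: ltW.
(* With [y = z / 2] the claim reads [4 * y ^+ 2 <= (expR y - expR (- y)) ^+ 2], which follows from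
   [0 <= f y]; the derivative [expR y + expR (- y) - 2] of [f] is the square [df y]. *)
pose f (y : R) := expR y - expR (- y) - 2 * y.
pose df (y : R) := (expR (y / 2) - expR (- (y / 2))) ^+ 2.
have expR2 (y : R) : expR y = expR (y / 2) ^+ 2.
  by rewrite -expRM_natl; congr expR; lra.
have expRV (y : R) : expR y * expR (- y) = 1 by rewrite expRxMexpNx_1.
have fE (y : R) : is_derive y 1 f (df y).
  rewrite /f /df; apply: is_derive_eq.
  rewrite /GRing.scale /= (expR2 y) (expR2 (- y)) mulNr.
  have := expRV (y / 2); nra.
pose y := z / 2.
have y0 : 0 <= y by rewrite /y; lra.
have sinh_ge : 2 * y <= expR y - expR (- y).
  have cf : continuous f.
    by move=> x; apply: differentiable_continuous; apply/derivable1_diffP; case: (fE x).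
  have [|c _] := @MVT_segment R f df 0 y y0.
  - exact: continuous_subspaceT.
  have -> : f 0 = 0 by rewrite /f oppr0 subrr mulr0 subr0.
  have : 0 <= df c by exact: sqr_ge0.
  by rewrite /f !subr0 => c0 E; rewrite -subr_ge0 E mulr_ge0.
have zE : z = 2 * y by rewrite /y; lra.
rewrite (expR2 z) (expR2 (- z)) mulNr -/y zE.
have := expRV y; nra.
Qed.

(** * Real-valued integrals under a probability *)

Section real_integrable.
Context d (T : measurableType d) (R : realType) (P : probability T R).
Implicit Types f g : T -> R.

Lemma integrable_EFinD f g :
  P.-integrable setT (EFin \o f) -> P.-integrable setT (EFin \o g) ->
  P.-integrable setT (EFin \o (fun w => f w + g w)).
Proof. by move=> fi gi; exact: (integrableD measurableT fi gi). Qed.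

Lemma integrable_EFinZl (k : R) f :
  P.-integrable setT (EFin \o f) ->
  P.-integrable setT (EFin \o (fun w => k * f w)).
Proof. by move=> fi; exact: (integrableZl measurableT k fi). Qed.

Lemma integrable_EFin_cst (c : R) : P.-integrable setT (EFin \o (fun _ : T => c)).
Proof. exact: finite_measure_integrable_cst. Qed.

Lemma integrable_EFin_sqr f : measurable_fun setT f ->
  P.-integrable setT (EFin \o (fun w => f w ^+ 2)) ->
  P.-integrable setT (EFin \o f).
Proof.
move=> mf f2.
have i1 : P.-integrable setT (EFin \o (fun w => 1 + f w ^+ 2)).
  by apply: integrable_EFinD f2; exact: integrable_EFin_cst.
apply: (le_integrable measurableT _ _ i1) => /=; first exact/measurable_EFinP.
move=> w _; rewrite lee_fin [leRHS]ger0_norm ?addr_ge0 ?sqr_ge0//.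
rewrite -real_normK ?num_real//; have := normr_ge0 (f w).
by set a := `|f w|; nra.
Qed.

Lemma Rintegral_probability_cst (c : R) : \int[P]_w c = c.
Proof. by rewrite /Rintegral integral_cst// [X in (_ * X)%E]probability_setT mule1. Qed.

Lemma Rintegral_affine (c k : R) f : P.-integrable setT (EFin \o f) ->
  \int[P]_w (c + k * f w) = c + k * \int[P]_w f w.
Proof.
move=> fi; rewrite RintegralD//; last 2 first.
- exact: integrable_EFin_cst.
- exact: integrable_EFinZl.
by rewrite RintegralZl// Rintegral_probability_cst.
Qed.

End real_integrable.

(** * Moments read off a Gaussian moment generating function *)

Section subgaussian_moments.
Context d (T : measurableType d) (R : realType) (P : probability T R).
Variables (Z : T -> R) (v : R).
Hypotheses (mZ : measurable_fun setT Z) (v0 : 0 < v).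
Hypothesis Z_mgf : forall t,
  (\int[P]_w (expR (t * Z w))%:E = (expR (t ^+ 2 * v / 2))%:E)%E.

Let intexp t : P.-integrable setT (EFin \o (fun w => expR (t * Z w))).
Proof.
apply/integrableP; split.
  by apply/measurable_EFinP; apply: measurableT_comp => //; exact: measurable_funM.
under eq_integral do rewrite /= ger0_norm ?expR_ge0//.
by rewrite Z_mgf ltry.
Qed.

Let Rintexp t : \int[P]_w expR (t * Z w) = expR (t ^+ 2 * v / 2).
Proof. by rewrite /Rintegral Z_mgf. Qed.

Let intsum t : P.-integrable setT (EFin \o (fun w => expR (t * Z w) + expR (- t * Z w))).
Proof. exact: integrable_EFinD. Qed.

Lemma subgaussian_integrable_sqr : P.-integrable setT (EFin \o (fun w => Z w ^+ 2)).
Proof.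
apply: (le_integrable measurableT _ _ (intsum 1)) => /=.
  by apply/measurable_EFinP; exact: measurable_funX.
move=> w _; rewrite lee_fin !ger0_norm ?sqr_ge0 ?addr_ge0 ?expR_ge0//.
by rewrite mul1r mulN1r (le_trans _ (sqr_le_expRDN _))// lerDr.
Qed.

Lemma subgaussian_integrable : P.-integrable setT (EFin \o Z).
Proof.
exact: integrable_EFin_sqr subgaussian_integrable_sqr.
Qed.

(* [expR c <= 1 / (1 - c)] *)
Let expR_le (c : R) : 0 <= c <= 1 / 2 -> expR c <= 1 + 2 * c.
Proof.
move=> /andP[c0 c1]; have := expR_ge1Dx (- c).
have : expR c * expR (- c) = 1 by rewrite expRxMexpNx_1.
have := expR_gt0 c; have := expR_gt0 (- c); nra.
Qed.

(** Integrating [sqr_le_expRDN] at [t * Z] with [t ^+ 2 * v = 1] bounds [2 + t ^+ 2 * I], [I] being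
    the second moment, by [2 * expR (1 / 2)], which is at most 4. *)
Lemma subgaussian_sqr_le : \int[P]_w Z w ^+ 2 <= 2 * v.
Proof.
pose t := (Num.sqrt v)^-1.
have t2 : t ^+ 2 * v = 1.
  by rewrite /t exprVn sqr_sqrtr ?ltW// mulVf ?gt_eqF.
have : \int[P]_w (2 + t ^+ 2 * Z w ^+ 2) <= \int[P]_w (expR (t * Z w) + expR (- t * Z w)).
  apply: le_Rintegral => //.
    apply: integrable_EFinD; first exact: integrable_EFin_cst.
    exact: integrable_EFinZl subgaussian_integrable_sqr.
  by move=> w _; rewrite mulNr -exprMn sqr_le_expRDN.
have iS := subgaussian_integrable_sqr.
rewrite Rintegral_affine// RintegralD// !Rintexp sqrrN t2.
have : expR (1 / 2) <= 1 + 2 * (1 / 2) :> R by apply: expR_le; apply/andP; split; lra.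
set I := Rintegral _ _ _ => e12 tI.
have t2I : t ^+ 2 * I <= 2 by lra.
have -> : I = (t ^+ 2 * I) * v by rewrite mulrAC t2 mul1r.
by rewrite ler_pM2r.
Qed.

(** Integrating [1 + t * Z <= expR (t * Z)] gives [t * a <= t ^+ 2 * v] for small [t] of either
    sign; a nonzero linear term cannot stay below a quadratic one near 0. *)
Lemma subgaussian_mean0 : \int[P]_w Z w = 0.
Proof.
set a := Rintegral _ _ _.
have iZ := subgaussian_integrable.
have key t : t ^+ 2 * v <= 1 -> t * a <= t ^+ 2 * v.
  move=> tv.
  have : \int[P]_w (1 + t * Z w) <= \int[P]_w (expR (t * Z w)).
    apply: le_Rintegral => //.
      by apply: integrable_EFinD; [exact: integrable_EFin_cst|exact: integrable_EFinZl].
    by move=> w _; exact: expR_ge1Dx.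
  rewrite Rintegral_affine// Rintexp -/a.
  have : 0 <= t ^+ 2 * v by rewrite mulr_ge0 ?sqr_ge0 ?ltW.
  move=> t0; have := @expR_le (t ^+ 2 * v / 2).
  have -> : 0 <= t ^+ 2 * v / 2 <= 1 / 2 by apply/andP; split; lra.
  by move=> /(_ isT); lra.
apply/eqP; case: eqVneq => // a0.
have a2 : 0 < a ^+ 2 by rewrite exprn_even_gt0.
have D0 : 0 < v + a ^+ 2 by rewrite addr_gt0.
(* [key] at this [t] gives [t ^+ 2 * a ^+ 2 <= 0]. *)
pose t := a / (v + a ^+ 2).
have tD : t * (v + a ^+ 2) = a by rewrite /t divfK ?gt_eqF.
have t2 : 0 < t ^+ 2.
  by rewrite exprn_even_gt0//= /t mulf_neq0// invr_eq0 gt_eqF.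
have tv : t ^+ 2 * v <= 1.
  by rewrite /t expr_div_n mulrAC ler_pdivrMr ?exprn_gt0// mul1r; nra.
have := key t tv; rewrite -[X in t * X <= _]tD mulrA -expr2 mulrDr -subr_ge0.
by rewrite opprD addNKr oppr_ge0 leNgt mulr_gt0.
Qed.

End subgaussian_moments.

(** * Moment generating function of the normal law *)

Section normal_law.
Context d (T : measurableType d) (R : realType) (P : probability T R).
Variables (Y : {RV P >-> R}) (m v : R).
Hypothesis v0 : 0 < v.
Hypothesis Y_law : forall A : set R, measurable A ->
  distribution P Y A = Normal m v A.

Lemma normal_law_mgf t :
  (\int[P]_w (expR (t * (Y w - m)))%:E = (expR (t ^+ 2 * v / 2))%:E)%E.
Proof.
pose sg := Num.sqrt v.
have sg0 : sg != 0 by rewrite gt_eqF// sqrtr_gt0.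
have sg2 : sg ^+ 2 = v by rewrite sqr_sqrtr// ltW.
have mexp : measurable_fun [set: R] (fun x : R => (expR (t * (x - m)))%:E).
  apply/measurable_EFinP; apply: measurableT_comp => //.
  by apply: measurable_funM => //; exact: measurable_funB.
transitivity (\int[distribution P Y]_x (expR (t * (x - m)))%:E)%E.
  by rewrite ge0_integral_distribution// => x; rewrite lee_fin expR_ge0.
have m'E (A : set R) : measurable A -> (distribution P Y A =
    \int[lebesgue_measure]_x (\1_A (idfun x) * normal_pdf m sg x)%:E)%E.
  move=> mA; rewrite Y_law// /Normal/= /normal_prob integral_mkcond.
  apply: eq_integral => x _; rewrite patchE indicE.
  by case: (x \in A); rewrite ?mul1r ?mul0r.
(* The identity links the two copies of the real line that carry Lebesgue measure and the law of
   [Y]. *)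
have mid : measurable_fun [set: measurableTypeR R] (idfun : measurableTypeR R -> R).
  exact: measurable_id.
rewrite (ge0_integral_density mid (measurable_normal_pdf m sg) (normal_pdf_ge0 m sg) m'E)//.
(* Completing the square: the exponential tilt shifts the centre of the normal density by [t * v],
   up to a constant factor. *)
transitivity (\int[lebesgue_measure]_x ((expR (t ^+ 2 * v / 2))%:E * (normal_pdf (m + t * v) sg x)%:E))%E.
  apply: eq_integral => x _; rewrite -!EFinM; congr EFin.
  rewrite !normal_pdfE// /normal_fun [LHS]mulrCA [RHS]mulrCA -!expRD.
  by congr (_ * expR _); rewrite sg2 -mulr_natr /=; field; rewrite gt_eqF.
rewrite ge0_integralZl//.
- by rewrite integral_normal_pdf mule1.
- by apply/measurable_EFinP; exact: measurable_normal_pdf.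
- by move=> x _; rewrite lee_fin normal_pdf_ge0.
Qed.

End normal_law.

(** * Transfer of the moments of [mu] to a variable with law [mu] *)

Section square_integrable_law.
Context d (T : measurableType d) (R : realType) (P : probability T R).
Variables (Y : {RV P >-> R}) (mu : probability (measurableTypeR R) R).
Hypothesis mu_var : finite_variance mu.
Hypothesis Y_law : forall A : set R, measurable A -> distribution P Y A = mu A.

(* [R] and [measurableTypeR R] have the same measurable sets but different
   displays, hence different types of measures. *)
Let YR : T -> measurableTypeR R := Y.

Let mYR : measurable_fun setT YR.
Proof. by move=> mT B mB; exact: (@measurable_funPT _ _ _ _ Y mT B mB). Qed.

Let mid : measurable_fun [set: measurableTypeR R] (fun x : measurableTypeR R => x : R).
Proof. exact: measurable_id. Qed.

Let pushE (f : measurableTypeR R -> \bar R) :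
  (\int[pushforward P YR]_x f x = \int[mu]_x f x)%E.
Proof. by apply: eq_measure_integral => A mA _; exact: Y_law. Qed.

Let ge0_transfer (f : R -> R) : measurable_fun [set: R] f -> (forall x, 0 <= f x) ->
  (\int[P]_w (f (Y w))%:E = \int[mu]_x (f x)%:E)%E.
Proof.
move=> mf f0; rewrite -pushE (ge0_integral_pushforward mYR)//; last by move=> x _; rewrite lee_fin.
by apply/measurable_EFinP; exact: mf.
Qed.

Let m := mean mu.

Let var_fin : (\int[P]_w ((Y w - m) ^+ 2)%:E < +oo)%E.
Proof.
rewrite (@ge0_transfer (fun x => (x - m) ^+ 2)).
- move: mu_var; rewrite /finite_variance /variance unlock unlock.
  rewrite /m /mean.
  congr (_ < _)%E.
  by rewrite unlock; apply: eq_integral => x _; rewrite expr2.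
- by apply: measurable_funX; exact: measurable_funB.
- by move=> x; exact: sqr_ge0.
Qed.

(** The centre [m] is real by definition, so [var_fin] controls [Y] before its mean is known to
    exist. *)
Lemma square_integrable_sqr : P.-integrable setT (EFin \o (fun w => Y w ^+ 2)).
Proof.
have mY : measurable_fun setT (Y : T -> R) by exact: measurable_funPT.
have i1 : P.-integrable setT (EFin \o (fun w => (Y w - m) ^+ 2)).
  apply/integrableP; split.
    by apply/measurable_EFinP; apply: measurable_funX; exact: measurable_funB.
  under eq_integral do rewrite /= ger0_norm ?sqr_ge0//.
  exact: var_fin.
have i2 : P.-integrable setT (EFin \o (fun w => 2 * m ^+ 2 + 2 * (Y w - m) ^+ 2)).
  by apply: integrable_EFinD; [exact: integrable_EFin_cst|exact: integrable_EFinZl].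
apply: (le_integrable measurableT _ _ i2) => /=.
  by apply/measurable_EFinP; exact: measurable_funX.
move=> w _; rewrite lee_fin ger0_norm ?sqr_ge0// ler_normr; apply/orP; left.
(* This square is the gap between the two sides of the domination. *)
have := sqr_ge0 (Y w - 2 * m); nra.
Qed.

Lemma square_integrable_integrable : P.-integrable setT (EFin \o (Y : T -> R)).
Proof.
by apply: integrable_EFin_sqr square_integrable_sqr; exact: measurable_funPT.
Qed.

Lemma square_integrable_mean : \int[P]_w Y w = mean mu.
Proof.
rewrite /mean unlock /Rintegral -pushE (integral_pushforward mYR)//.
exact: square_integrable_integrable.
Qed.

Lemma square_integrable_second_moment : \int[P]_w Y w ^+ 2 = second_moment mu.
Proof.
rewrite /second_moment unlock /Rintegral; congr fine.
rewrite (@ge0_transfer (fun x => x ^+ 2))//.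
by move=> x; exact: sqr_ge0.
Qed.

End square_integrable_law.

(** * Jensen's inequality for the exponential *)

Section jensen.
Context d (T : measurableType d) (R : realType) (P : probability T R).

Lemma jensen_expR (U : T -> R) : P.-integrable setT (EFin \o U) ->
  P.-integrable setT (EFin \o (fun w => expR (U w))) ->
  expR (\int[P]_w U w) <= \int[P]_w expR (U w).
Proof.
move=> iU iE; set g := Rintegral _ _ _.
(* The tangent line of [expR] at the mean [g]. *)
pose tg w := expR g * (1 - g) + expR g * U w.
have -> : expR g = \int[P]_w tg w.
  by rewrite Rintegral_affine// -/g; ring.
apply: le_Rintegral => //.
  by apply: integrable_EFinD; [exact: integrable_EFin_cst|exact: integrable_EFinZl].
move=> w _; rewrite /tg -mulrDr.
have -> : U w = g + (U w - g) by ring.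
rewrite expRD ler_wpM2l ?expR_ge0//.
by have := expR_ge1Dx (U w - g); lra.
Qed.

End jensen.

(** * Deviation bound for a general unbiased noise map *)

Section smoothed_estimator.
Context d (T : measurableType d) (R : realType) (P : probability T R) (n : nat).
Variables (X eps : 'I_n -> {RV P >-> R}) (h : R -> R -> R).
Variables (s a b m m2 L : R).
Hypothesis n0 : (0 < n)%N.
Hypothesis s0 : 0 < s.
Hypothesis X_indep : mutually_independent P X.
Hypothesis X_int : forall i, P.-integrable setT (EFin \o (X i : T -> R)).
Hypothesis X_int2 : forall i, P.-integrable setT (EFin \o (fun w => X i w ^+ 2)).
Hypothesis X_mean : forall i, \int[P]_w X i w = m.
Hypothesis X_sqr : forall i, \int[P]_w X i w ^+ 2 = m2.
Hypothesis mh : measurable_fun setT (fun z : R * R => h z.1 z.2).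
Hypothesis h_int : forall i x, P.-integrable setT (EFin \o (fun w => h x (eps i w))).
Hypothesis h_int2 : forall i x,
  P.-integrable setT (EFin \o (fun w => h x (eps i w) ^+ 2)).
Hypothesis h_mean : forall i x, \int[P]_w h x (eps i w) = x.
Hypothesis h_sqr : forall i x,
  \int[P]_w h x (eps i w) ^+ 2 <= a * x ^+ 2 + b.

Let U i x w : R := psi (h x (eps i w) / s).
Let G i x : R := \int[P]_w U i x w.

Let mU2 i : measurable_fun [set: R * T] (fun z => U i z.1 z.2).
Proof.
apply: (measurableT_comp measurable_psi); apply: measurable_funM => //.
apply: (measurableT_comp (f := fun z : R * R => h z.1 z.2) mh
  (g := fun z : R * T => (z.1, eps i z.2))).
by apply: measurable_fun_pair => //; exact: measurableT_comp.
Qed.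

Let mU i x : measurable_fun setT (U i x).
Proof.
exact: (measurableT_comp (mU2 i) (pair1_measurable x)).
Qed.

Let iU i x : P.-integrable setT (EFin \o U i x).
Proof.
apply: (le_integrable measurableT _ _ (integrable_EFin_cst P 1)) => /=.
  exact/measurable_EFinP.
by move=> w _; rewrite lee_fin normr1 psi_le1.
Qed.

(** Tonelli's theorem gives measurability of a parameter integral for nonnegative integrands; adding
    1 makes the integrand nonnegative, since [psi] is at least -1. *)
Let mG i : measurable_fun setT (G i).
Proof.
have E x : ((G i x + 1)%:E = \int[P]_w (U i x w + 1)%:E)%E.
  have -> : G i x + 1 = \int[P]_w (1 + 1 * U i x w).
    by rewrite Rintegral_affine// mul1r addrC.
  rewrite fineK; first by apply: eq_integral => w _; rewrite mul1r addrC.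
  apply: integrable_fin_num => //.
  by apply: integrable_EFinD; [exact: integrable_EFin_cst|exact: integrable_EFinZl].
have mG1 : measurable_fun setT (fun x => G i x + 1).
  apply/measurable_EFinP.
  rewrite (_ : EFin \o _ = fubini_F P (fun z : R * T => (U i z.1 z.2 + 1)%:E)).
    apply: measurable_fun_fubini_tonelli_F.
    - by apply/measurable_EFinP; exact: measurable_funD.
    - move=> z; rewrite lee_fin; have := psi_le1 (h z.1 (eps i z.2) / s).
      by rewrite ler_norml /U; lra.
  by apply/funext => x; rewrite /fubini_F -E.
rewrite (_ : G i = fun x => (G i x + 1) - 1); last by apply/funext => x; rewrite addrK.
exact: measurable_funB.
Qed.

(** The data average of the quadratic term in the exponential bound on [G]. *)
Let V := (a * m2 + b) / (2 * s ^+ 2).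

(* [sg] is 1 for the upper tail and -1 for the lower one. *)
Let expR_G_le (sg : R) : sg ^+ 2 = 1 -> (forall u : R, psi (sg * u) = sg * psi u) ->
  forall i x, expR (sg * G i x) <= 1 + sg * x / s + (a * x ^+ 2 + b) / (2 * s ^+ 2).
Proof.
move=> sg2 psis i x.
have s2 : 0 < (2 * s ^+ 2)^-1 by rewrite invr_gt0 mulr_gt0// exprn_gt0.
have EG : sg * G i x = \int[P]_w (sg * U i x w) by rewrite RintegralZl.
have mE : measurable_fun setT (fun w => expR (sg * U i x w)).
  by apply: measurableT_comp => //; exact: measurable_funM.
have iE : P.-integrable setT (EFin \o (fun w => expR (sg * U i x w))).
  apply: (le_integrable measurableT _ _ (integrable_EFin_cst P (expR 1))) => /=.
    exact/measurable_EFinP.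
  move=> w _; rewrite lee_fin !ger0_norm ?expR_ge0// ler_expR.
  rewrite -psis (le_trans (ler_norm _))//; exact: psi_le1.
rewrite EG; apply: le_trans (jensen_expR _ iE) _; first exact: integrable_EFinZl.
(* The quadratic of [expR_psi_le] at [sg * (h x (eps i w) / s)]; the sign disappears from the
   square. *)
pose W w := (1 + sg / s * h x (eps i w)) + (2 * s ^+ 2)^-1 * h x (eps i w) ^+ 2.
have iW1 : P.-integrable setT (EFin \o (fun w => 1 + sg / s * h x (eps i w))).
  by apply: integrable_EFinD; [exact: integrable_EFin_cst|exact: integrable_EFinZl].
apply: (@le_trans _ _ (\int[P]_w W w)).
  apply: le_Rintegral => //.
    by apply: integrable_EFinD => //; exact: integrable_EFinZl.
  move=> w _; rewrite -psis (le_trans (expR_psi_le _))//.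
  rewrite exprMn sg2 /W le_eqVlt; apply/orP; left; apply/eqP.
  by field; rewrite gt_eqF.
rewrite RintegralD//; last exact: integrable_EFinZl.
rewrite Rintegral_affine// RintegralZl// h_mean.
rewrite (mulrAC sg) lerD2l [leRHS]mulrC ler_wpM2l// ltW//.
Qed.

Let expR_G_mean (sg : R) : sg ^+ 2 = 1 -> (forall u : R, psi (sg * u) = sg * psi u) ->
  forall i, (\int[P]_w (expR (sg * G i (X i w)))%:E <= (expR (sg * m / s + V))%:E)%E.
Proof.
move=> sg2 psis i.
pose W w := (1 + b / (2 * s ^+ 2) + sg / s * X i w) + a / (2 * s ^+ 2) * X i w ^+ 2.
have iW1 : P.-integrable setT (EFin \o (fun w => 1 + b / (2 * s ^+ 2) + sg / s * X i w)).
  by apply: integrable_EFinD; [exact: integrable_EFin_cst|exact: integrable_EFinZl].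
have iW : P.-integrable setT (EFin \o W).
  by apply: integrable_EFinD => //; exact: integrable_EFinZl.
apply: (@le_trans _ _ (\int[P]_w (W w)%:E)%E).
  apply: ge0_le_integral => //.
  - apply/measurable_EFinP; apply: measurableT_comp => //; apply: measurable_funM => //.
    exact: measurableT_comp.
  - by case/integrableP : iW.
  - move=> w _; rewrite lee_fin (le_trans (expR_G_le sg2 psis i _))// /W.
    by rewrite le_eqVlt; apply/orP; left; apply/eqP; field; rewrite gt_eqF.
have -> : (\int[P]_w (W w)%:E = (\int[P]_w W w)%:E)%E.
  by rewrite /Rintegral fineK//; exact: integrable_fin_num.
rewrite lee_fin RintegralD//; last exact: integrable_EFinZl.
rewrite Rintegral_affine// RintegralZl// X_mean X_sqr.
apply: le_trans (expR_ge1Dx _); rewrite /V le_eqVlt; apply/orP; left; apply/eqP.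
by field; rewrite gt_eqF.
Qed.

Let tail (sg : R) : sg ^+ 2 = 1 -> (forall u : R, psi (sg * u) = sg * psi u) ->
  (P [set w | (n%:R * (sg * m / s + V) + L <= \sum_i sg * G i (X i w))%R]
    <= (expR (- L))%:E)%E.
Proof.
move=> sg2 psis.
apply: (independent_chernoff X_indep (G := fun i x => sg * G i x)) => i.
  exact: measurable_funM.
exact: expR_G_mean.
Qed.

Lemma smoothed_estimator_deviation (B : R) :
  s * V + s * L / n%:R <= B ->
  ((1 - 2 * expR (- L))%:E <= P [set w |
    (`| fine 'E_P[(fun w' => s / n%:R * \sum_(i < n) psi (h (X i w) (eps i w') / s))%R]%E
        - m | <= B)%R])%E.
Proof.
move=> VB.
have nR0 : 0 < n%:R :> R by rewrite ltr0n.
(* With the data frozen, linearity of the noise expectation makes the estimator a sum of functions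
   of single observations. *)
have estE w : fine 'E_P[(fun w' => s / n%:R * \sum_(i < n) psi (h (X i w) (eps i w') / s))%R]%E
    = s / n%:R * \sum_i G i (X i w).
  have iS : P.-integrable setT (EFin \o (fun w' => \sum_(i < n) U i (X i w) w')).
    rewrite (_ : EFin \o _ = fun w' => (\sum_(i < n) (U i (X i w) w')%:E)%E).
      by apply: integrable_sum => // i _; exact: iU.
    by apply/funext => w' /=; rewrite sumEFin.
  rewrite unlock -/(Rintegral P setT _) RintegralZl//; congr (_ * _).
  rewrite /Rintegral.
  under eq_integral do rewrite -sumEFin.
  rewrite integral_sum//; last by move=> i; exact: iU.
  rewrite /G /Rintegral sum_fine// => i _.
  by apply: integrable_fin_num => //; exact: iU.
have mS sg : measurable_fun setT (fun w => \sum_i sg * G i (X i w)).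
  apply: measurable_sum => i; apply: measurable_funM => //; exact: measurableT_comp.
pose A (sg : R) := [set w | (n%:R * (sg * m / s + V) + L <= \sum_i sg * G i (X i w))%R].
have mA sg : measurable (A sg).
  rewrite /A -[X in measurable X]setTI.
  exact: (measurable_fun_ler (measurable_cst _) (mS sg) measurableT (I : measurable [set true])).
under eq_set => w do rewrite estE.
set S := [set w | _].
have mS' : measurable S.
  rewrite /S -[X in measurable X]setTI.
  have mG' : measurable_fun setT (fun w => `|s / n%:R * \sum_i G i (X i w) - m|).
    apply: measurableT_comp => //; apply: measurable_funB => //; apply: measurable_funM => //.
    by apply: measurable_sum => i; exact: measurableT_comp.
  exact: (measurable_fun_ler mG' (measurable_cst _) measurableT (I : measurable [set true])).
(* Multiplication by [n%:R / s] carries the threshold [s * V + s * L / n%:R] to [n%:R * V + L]; the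
   two signs of the deviation then give [A 1] and [A (-1)]. *)
have SA : ~` S `<=` A 1 `|` A (-1).
  move=> w /= /negP; rewrite -ltNge => BS.
  have {BS} := le_lt_trans VB BS.
  rewrite /A /= -!mulr_sumr mul1r mulN1r mul1r.
  set Q := \sum_i _ => dev.
  have key : n%:R / s * (s * V + s * L / n%:R) = n%:R * V + L.
    by field; rewrite !gt_eqF.
  have {}dev : n%:R * V + L < n%:R / s * `|s / n%:R * Q - m|.
    by rewrite -key ltr_pM2l// divr_gt0.
  have ns : 0 < n%:R / s by rewrite divr_gt0.
  have E : n%:R / s * `|s / n%:R * Q - m| = `|Q - n%:R * m / s|.
    rewrite -[X in X * `|_|]gtr0_norm// -normrM; congr `|_|.
    by field; rewrite !gt_eqF.
  move: dev; rewrite E lter_normr => /orP[dev|dev]; [left|right].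
    by apply: ltW; rewrite mulrDr mulrA; lra.
  by apply: ltW; rewrite mulrDr mulN1r mulNr mulrN mulrA; lra.
have PA sg : sg ^+ 2 = 1 -> (forall u : R, psi (sg * u) = sg * psi u) ->
  (P (A sg) <= (expR (- L))%:E)%E := @tail sg.
have PS : (P (~` S) <= (2 * expR (- L))%:E)%E.
  apply: (@le_trans _ _ (P (A 1 `|` A (-1)))).
    by apply: le_measure => //; rewrite inE; [exact: measurableC|exact: measurableU].
  apply: le_trans (measureU2 _ _ _) _ => //.
  rewrite mulrDl mul1r EFinD; apply: leeD; apply: PA.
  - by rewrite expr1n.
  - by move=> u; rewrite !mul1r.
  - by rewrite sqrrN expr1n.
  - by move=> u; rewrite !mulN1r psiN.
have <- : (1 - P (~` S) = P S)%E.
  by rewrite -probability_setC ?setCK//; exact: measurableC.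
by rewrite EFinB leeB.
Qed.

End smoothed_estimator.

(** * Moments of affine images of centred noise *)

Section centred_noise.
Context d (T : measurableType d) (R : realType) (P : probability T R).
Variables (Z : T -> R) (v : R).
Hypotheses (Z_int : P.-integrable setT (EFin \o Z))
  (Z_int2 : P.-integrable setT (EFin \o (fun w => Z w ^+ 2))).
Hypotheses (Z_mean : \int[P]_w Z w = 0) (Z_sqr : \int[P]_w Z w ^+ 2 <= v).

(** With [Z] the noise minus its mean, additive noise is the case [c = x], [k = 1], and
    multiplicative noise of mean 1 the case [c = k = x]. *)
Lemma affine_noise_integrable c k :
  P.-integrable setT (EFin \o (fun w => c + k * Z w)).
Proof. by apply: integrable_EFinD; [exact: integrable_EFin_cst|exact: integrable_EFinZl]. Qed.

Lemma affine_noise_mean c k : \int[P]_w (c + k * Z w) = c.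
Proof. by rewrite Rintegral_affine// Z_mean mulr0 addr0. Qed.

Let sqrE c k w : (c + k * Z w) ^+ 2 = (c ^+ 2 + (2 * c * k) * Z w) + k ^+ 2 * Z w ^+ 2.
Proof. ring. Qed.

Lemma affine_noise_integrable_sqr c k :
  P.-integrable setT (EFin \o (fun w => (c + k * Z w) ^+ 2)).
Proof.
rewrite (_ : EFin \o _ = EFin \o (fun w => (c ^+ 2 + (2 * c * k) * Z w) + k ^+ 2 * Z w ^+ 2)).
  by apply: integrable_EFinD; [exact: affine_noise_integrable|exact: integrable_EFinZl].
by apply/funext => w /=; rewrite sqrE.
Qed.

Lemma affine_noise_sqr_le c k :
  \int[P]_w (c + k * Z w) ^+ 2 <= c ^+ 2 + k ^+ 2 * v.
Proof.
under eq_Rintegral do rewrite sqrE.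
rewrite RintegralD//; last 2 first.
- exact: affine_noise_integrable.
- exact: integrable_EFinZl.
by rewrite affine_noise_mean RintegralZl// lerD2l ler_wpM2l ?sqr_ge0.
Qed.

End centred_noise.

(** * The two noise models at the prescribed scales *)

Theorem proposition4 (R : realType) (d : measure_display)
    (T : measurableType d) (P : probability T R) (n : nat) (hn : (1 <= n)%N)
    (mu : probability (measurableTypeR R) R) (X : 'I_n -> {RV P >-> R})
    (X_iid : iid P X mu)
    (mu_var : finite_variance mu)
    (mu_pos : 0 < second_moment mu)
    (delta : R) (hdelta : 0 < delta < 1)
    (s : R) (hs0 : 0 < s)
    (hs : s ^+ 2 = n%:R * second_moment mu / (2 * ln (delta^-1))) :
  (forall (beta : R) (eps : 'I_n -> {RV P >-> R}),
     0 < beta -> beta ^+ 2 = n%:R / s ^+ 2 ->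
     iid P eps (Normal 0 beta^-1) ->
     independent_families P X eps ->
     ((1 - 2 * delta)%:E <=
       P [set w | (`| additive_estimator P s X eps w - mean mu |
                  <= Num.sqrt (2 * second_moment mu * ln (delta^-1) / n%:R)
                     + 1 / Num.sqrt n%:R)%R])%E)
  /\
  (forall (beta : R) (eps : 'I_n -> {RV P >-> R}),
     0 < beta -> beta ^+ 2 = n%:R * second_moment mu / s ^+ 2 ->
     iid P eps (Normal 1 beta^-1) ->
     independent_families P X eps ->
     ((1 - 2 * delta)%:E <=
       P [set w | (`| multiplicative_estimator P s X eps w - mean mu |
                  <= Num.sqrt (2 * second_moment mu * ln (delta^-1) / n%:R)
                     + Num.sqrt (second_moment mu / n%:R))%R])%E).
Proof.
pose m2 := second_moment mu; pose L := ln delta^-1.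
have [d0 d1] := andP hdelta.
have L0 : 0 < L by rewrite /L ln_gt0// invf_gt1.
have expL : expR (- L) = delta by rewrite /L lnV ?posrE// opprK lnK// posrE.
have nR0 : 0 < n%:R :> R by rewrite ltr0n.
have X_law i : forall A : set R, measurable A -> distribution P (X i) A = mu A.
  by move=> A mA; exact: X_iid.2.
have X_int i := square_integrable_integrable mu_var (X_law i).
have X_int2 i := square_integrable_sqr mu_var (X_law i).
have X_mean i := square_integrable_mean mu_var (X_law i).
have X_sqr i := square_integrable_second_moment (X_law i).
have sn0 : s != 0 by rewrite gt_eqF.
have m2E : m2 = s ^+ 2 * (2 * L) / n%:R.
  by rewrite hs -/m2 -/L divfK ?mulf_neq0 ?gt_eqF// mulrAC divff ?mul1r// gt_eqF.
(* The choice of [s] balances the Chernoff term [s * L / n%:R] against the data part [m2 / (2 * s)]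
   of [s * V]; together they give [m2 / s], the first square root of the bound. *)
have sLn : s * L / n%:R = m2 / (2 * s).
  by rewrite m2E; field; rewrite sn0 gt_eqF.
have qE : Num.sqrt (2 * m2 * L / n%:R) = m2 / s.
  rewrite -[RHS]gtr0_norm ?divr_gt0// -sqrtr_sqr; congr Num.sqrt.
  by rewrite m2E; field; rewrite sn0 gt_eqF.
have noise (m0 : R) (beta : R) (eps : 'I_n -> {RV P >-> R}) : 0 < beta ->
    iid P eps (Normal m0 beta^-1) -> forall i,
    let Z w := eps i w - m0 in
    [/\ P.-integrable setT (EFin \o Z), P.-integrable setT (EFin \o (fun w => Z w ^+ 2)),
        \int[P]_w Z w = 0 & \int[P]_w Z w ^+ 2 <= 2 * beta^-1].
  move=> b0 [_ eps_law] i Z.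
  have v0 : 0 < beta^-1 by rewrite invr_gt0.
  have mZ : measurable_fun setT Z by exact: measurable_funB.
  have mgf := normal_law_mgf v0 (fun A mA => eps_law i A mA).
  split.
  - exact: subgaussian_integrable mZ mgf.
  - exact: subgaussian_integrable_sqr mZ mgf.
  - exact: subgaussian_mean0 mZ v0 mgf.
  - exact: subgaussian_sqr_le mZ v0 mgf.
split=> beta eps b0 bE eps_iid _.
- have N i := noise 0 beta eps b0 eps_iid i.
  have hE i x w : x + eps i w = x + 1 * (eps i w - 0) by rewrite subr0 mul1r.
  rewrite -[X in 1 - 2 * X]expL /additive_estimator.
  (* The noise adds at most [2 * beta^-1] to the second moment [x ^+ 2], whence [a] and [b]. *)
  apply: (@smoothed_estimator_deviation _ _ _ P n X eps (fun x e => x + e) s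
    1 (2 * beta^-1) (mean mu) m2 L) => //.
  + exact: X_iid.1.
  + exact: measurable_funD.
  + move=> i x; have [Z1 Z2 Z3 Z4] := N i.
    rewrite (eq_fun (hE i x)); exact: affine_noise_integrable.
  + move=> i x; have [Z1 Z2 Z3 Z4] := N i.
    under eq_fun do rewrite hE; exact: affine_noise_integrable_sqr.
  + move=> i x; have [Z1 Z2 Z3 Z4] := N i.
    under eq_Rintegral do rewrite hE; exact: affine_noise_mean.
  + move=> i x; have [Z1 Z2 Z3 Z4] := N i.
    under eq_Rintegral do rewrite hE.
    by apply: le_trans (affine_noise_sqr_le Z1 Z2 Z3 Z4 _ _) _; rewrite mul1r expr1n mul1r.
  (* The remaining part of [s * V] is [1 / (beta * s)], the second term of the bound. *)
  + have bs : beta * s = Num.sqrt n%:R.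
      rewrite -[LHS]gtr0_norm ?mulr_gt0// -sqrtr_sqr; congr Num.sqrt.
      by rewrite exprMn bE divfK// expf_neq0.
    rewrite -/m2 -/L qE -bs sLn le_eqVlt; apply/orP; left; apply/eqP.
    by field; rewrite sn0 gt_eqF.
- have N i := noise 1 beta eps b0 eps_iid i.
  have hE i x w : x * eps i w = x + x * (eps i w - 1) by ring.
  rewrite -[X in 1 - 2 * X]expL /multiplicative_estimator.
  (* The noise is scaled by [x], so its second moment enters the coefficient of [x ^+ 2]. *)
  apply: (@smoothed_estimator_deviation _ _ _ P n X eps (fun x e => x * e) s
    (1 + 2 * beta^-1) 0 (mean mu) m2 L) => //.
  + exact: X_iid.1.
  + exact: measurable_funM.
  + move=> i x; have [Z1 Z2 Z3 Z4] := N i.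
    rewrite (eq_fun (hE i x)); exact: affine_noise_integrable.
  + move=> i x; have [Z1 Z2 Z3 Z4] := N i.
    under eq_fun do rewrite hE; exact: affine_noise_integrable_sqr.
  + move=> i x; have [Z1 Z2 Z3 Z4] := N i.
    under eq_Rintegral do rewrite hE; exact: affine_noise_mean.
  + move=> i x; have [Z1 Z2 Z3 Z4] := N i.
    under eq_Rintegral do rewrite hE.
    by apply: le_trans (affine_noise_sqr_le Z1 Z2 Z3 Z4 _ _) _; lra.
  (* The remaining part of [s * V] is [m2 / (beta * s)], and [(beta * s) ^+ 2 = n%:R * m2]. *)
  + have bs : Num.sqrt (m2 / n%:R) = m2 / (beta * s).
      rewrite -[RHS]gtr0_norm ?divr_gt0 ?mulr_gt0// -sqrtr_sqr; congr Num.sqrt.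
      rewrite expr_div_n exprMn bE divfK ?expf_neq0// -/m2.
      by field; rewrite !gt_eqF.
    rewrite -/m2 -/L qE bs sLn le_eqVlt; apply/orP; left; apply/eqP.
    by field; rewrite sn0 gt_eqF.
Qed.
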